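(* Consider a time-homogeneous discrete-time Markov chain on a countable state space $S$ with transition probabilities $P$, and two fixed states $x,y\in S$. If two copies $(X_n)_{n\in\mathbb{N}_0}$ and $(Y_n)_{n\in\mathbb{N}_0}$ of the chain, started in $x$ and $y$ respectively, can be coupled in such a way that their first meeting time $\tau=\inf\{n\ge 0: X_n=Y_n\}$ satisfies $\mathbb{P}(\tau<\infty)=1$, then $$\lim_{n\to\infty}\lVert P^n(x,\cdot)-P^n(y,\cdot)\rVert_{\mathrm{TV}}\le \tfrac12.$$
   Context: $P^n(x,\cdot)$ denotes the distribution of $X_n$ given $X_0=x$. For probability distributions $\mu,\nu$ on a countable set $S$, $\lVert\mu-\nu\rVert_{\mathrm{TV}}:=\sup_{A\subseteq S}|\mu(A)-\nu(A)|$. The sequence $\lVert P^n(x,\cdot)-P^n(y,\cdot)\rVert_{\mathrm{TV}}$ is non-increasing in $n$, so the limit exists. A coupling of two copies of the chain is a process $((X_n,Y_n))_{n\in\mathbb{N}_0}$ on $S\times S$ such that $(X_n)_{n\in\mathbb{N}_0}$ and $(Y_n)_{n\in\mathbb{N}_0}$ are each Markov chains on $S$ (with respect to their own natural filtrations) with transition probabilities $P$; the joint process is not required to be a Markov chain. *)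

(* Defs.v *)
From HB Require Import structures.
From mathcomp Require Import all_boot all_order all_algebra.
From mathcomp Require Import all_classical all_reals all_analysis.

Set Implicit Arguments.
Unset Strict Implicit.
Unset Printing Implicit Defensive.

Import Order.TTheory GRing.Theory Num.Theory.

Local Open Scope classical_set_scope.
Local Open Scope ring_scope.
Local Open Scope ereal_scope.

Definition transition_matrix (R : realType) (S : countType)
    (P : S -> S -> R) : Prop :=
  (forall s t, (0 <= P s t)%R) /\
  (forall s, \esum_(t in [set: S]) (P s t)%:E = 1).

Fixpoint transition_pow (R : realType) (S : countType) (P : S -> S -> R)
    (n : nat) (s t : S) : \bar R :=
  if n is m.+1 then \esum_(u in [set: S]) (P s u)%:E * transition_pow P m u t
  else (s == t)%:R%:E.

(* The distribution P^n(s, .), as a function of subsets of S. *)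
Definition nstep (R : realType) (S : countType) (P : S -> S -> R)
    (n : nat) (s : S) (A : set S) : \bar R :=
  \esum_(t in A) transition_pow P n s t.

Definition tv_dist (R : realType) (S : Type) (mu nu : set S -> \bar R) :
    \bar R :=
  ereal_sup [set `|mu A - nu A| | A in [set: set S]].

(* The sigma-algebra generated by X_0, ..., X_n, where S carries its discrete
   sigma-algebra. *)
Definition natural_filtration (Omega S : Type) (X : nat -> Omega -> S)
    (n : nat) : set (set Omega) :=
  <<s [set B | exists k (A : set S), (k <= n)%N /\ B = X k @^-1` A] >>.

(* The last clause says that P(X_n, t) is a version of the conditional
   probability of {X_(n+1) = t} given the natural filtration at time n; as
   P(X_n, t) is a function of X_n, it is measurable for that filtration. *)
Definition markov_chain d (Omega : measurableType d) (R : realType)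
    (Pr : probability Omega R) (S : countType) (P : S -> S -> R)
    (X : nat -> Omega -> S) : Prop :=
  (forall n (A : set S), measurable (X n @^-1` A)) /\
  (forall n (t : S) (F : set Omega), natural_filtration X n F ->
     Pr (F `&` X n.+1 @^-1` [set t]) = \int[Pr]_(w in F) (P (X n w) t)%:E).

Definition coupling d (Omega : measurableType d) (R : realType)
    (Pr : probability Omega R) (S : countType) (P : S -> S -> R) (x y : S)
    (X Y : nat -> Omega -> S) : Prop :=
  [/\ markov_chain Pr P X, markov_chain Pr P Y,
      Pr (X 0%N @^-1` [set x]) = 1 & Pr (Y 0%N @^-1` [set y]) = 1].

(* The infimum of the empty set is +oo. *)
Definition meeting_time (R : realType) (Omega S : Type)
    (X Y : nat -> Omega -> S) (w : Omega) : \bar R :=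
  ereal_inf [set n%:R%:E | n in [set n : nat | X n w = Y n w]].

(* Main.v *)
(* For a fixed horizon N and a set A, the process P^(N-k)(X_k, A), k <= N, is a
   [0,1]-valued martingale started at P^N(x, A). If X and Y meet at time k <= N,
   then either P^(N-k)(X_k, ~A) >= 1/2 or P^(N-k)(Y_k, A) >= 1/2, and Doob's
   maximal inequality, applied to each chain in its own filtration, gives
   Pr(tau <= N) <= 2 P^N(x, ~A) + 2 P^N(y, A). Hence
   P^N(x, A) - P^N(y, A) <= 1 - Pr(tau <= N) / 2 uniformly in A. *)

Require Import Defs.
From HB Require Import structures.
From mathcomp Require Import all_boot all_order all_algebra.
From mathcomp Require Import all_classical all_reals all_analysis.
From mathcomp Require Import lra.

Import Order.TTheory GRing.Theory Num.Theory.

Local Open Scope classical_set_scope.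
Local Open Scope ring_scope.
Local Open Scope ereal_scope.

(** * Nonnegative sums and countable additivity over fibres *)

Lemma ge0_esumZl {R : realType} {T : choiceType} (I : set T) (c : R)
    (a : T -> \bar R) : (0 <= c)%R -> (forall i, 0 <= a i) ->
  \esum_(i in I) c%:E * a i = c%:E * \esum_(i in I) a i.
Proof.
have esumZ_le (e : R) (b : T -> \bar R) : (0 <= e)%R -> (forall i, 0 <= b i) ->
    \esum_(i in I) e%:E * b i <= e%:E * \esum_(i in I) b i.
  move=> e0 b0; apply: ge_ereal_sup => /= _ [X [finX XI]] <-.
  rewrite -ge0_mule_fsumr//; apply: lee_wpmul2l; first by rewrite lee_fin.
  by apply: esum_ge; exists X.
move=> c0 a0; apply/eqP; rewrite eq_le esumZ_le//=.
have [->|cN0] := eqVneq c 0%R.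
  by rewrite mul0e esum_ge0// => i _; rewrite mul0e.
have cgt0 : (0 < c)%R by rewrite lt_neqAle eq_sym cN0.
(* The converse inequality is [esumZ_le] for the factor [c^-1] and the family [c%:E * a i]. *)
rewrite -lee_pdivlMl//; apply: le_trans (esumZ_le _ _ _ _).
- by apply: le_esum => i _; rewrite muleA -EFinM mulVf// mul1e.
- by rewrite invr_ge0.
- by move=> i; rewrite mule_ge0// lee_fin.
Qed.

Lemma esum_exchange {R : realType} {T1 T2 : choiceType} (I : set T1)
    (J : set T2) (a : T1 -> T2 -> \bar R) : (forall i j, 0 <= a i j) ->
  \esum_(i in I) \esum_(j in J) a i j = \esum_(j in J) \esum_(i in I) a i j.
Proof.
move=> a0; rewrite !esum_esum//.
rewrite (reindex_esum (J `*` I) _ (fun z => (z.2, z.1)))//; split=> //=.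
- by move=> [i j] [].
- by move=> [i1 i2] [j1 j2] /= _ _ [] -> ->.
- by move=> [i1 i2] [? ?] /=; exists (i2, i1).
Qed.

Lemma measure_esum_preimage {d} {Omega : measurableType d} {R : realType}
    (mu : {measure set Omega -> \bar R}) {S : countType} (X : Omega -> S)
    {B : set Omega} :
    measurable B -> (forall t, measurable (X @^-1` [set t])) ->
  mu B = \esum_(t in [set: S]) mu (B `&` X @^-1` [set t]).
Proof.
move=> mB mX.
(* Sigma-additivity needs a sequence of sets, so the fibres of [X] are indexed by their codes; a
   number that codes no state gives the empty set. *)
pose C n := B `&` [set w | pickle (X w) = n].
have CE t : C (pickle t) = B `&` X @^-1` [set t].
  congr (_ `&` _); apply/seteqP; split => w /= [].
    by move/(pcan_inj pickleK).
  by move=> ->.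
have C0 n : (forall t : S, pickle t <> n) -> C n = set0.
  by move=> nt; rewrite -subset0 => w [_ /nt].
have mC n : measurable (C n).
  case: (pselect (exists t : S, pickle t = n)) => [[t <-]|/forallNP/C0 ->] //.
  by rewrite CE; exact: measurableI.
rewrite [in LHS](_ : B = \bigcup_n C n); last first.
  apply/seteqP; split=> [w Bw|w [n _ []]//].
  by exists (pickle (X w)).
rewrite measure_semi_bigcup//; last 2 first.
- apply/trivIsetP => i j _ _ /eqP ij; rewrite -subset0 => w [[_ /= wi] [_ wj]].
  by apply: ij; rewrite -wi -wj.
- exact: bigcupT_measurable.
rewrite nneseries_esumT//.
rewrite (esumID (range (@pickle S)))// [X in _ + X]esum1 ?adde0; last first.
  by move=> n [_ nt]; rewrite C0// => t tn; apply: nt; exists t.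
rewrite setTI (esum_image setT); last first.
  by move=> s t _ _; exact: (pcan_inj pickleK).
by apply: eq_esum => t _; rewrite CE.
Qed.

(** * The [n]-step distributions *)

Section nstep.
Context {R : realType} {S : countType} {P : S -> S -> R}.
Hypothesis hP : transition_matrix P.

Lemma transition_pow_ge0 n s t : 0 <= transition_pow P n s t.
Proof.
elim: n s => [|n IH] s /=; first by rewrite lee_fin ler0n.
by apply: esum_ge0 => u _; rewrite mule_ge0// lee_fin (proj1 hP).
Qed.

Lemma nstep_ge0 n s A : 0 <= nstep P n s A.
Proof. by apply: esum_ge0 => t _; exact: transition_pow_ge0. Qed.

Lemma transition_pow0_esum s (f : S -> \bar R) : (forall t, 0 <= f t) ->
  \esum_(t in [set: S]) transition_pow P 0 s t * f t = f s.
Proof.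
move=> f0; rewrite (esumID [set s])/=; last first.
  by move=> t _; rewrite mule_ge0// lee_fin ler0n.
rewrite [X in _ + X]esum1 ?adde0; last first.
  by move=> t [_ /= ts]; case: eqP => [/esym//|]; rewrite mul0e.
by rewrite setTI esum_set1 ?eqxx ?mul1e.
Qed.

Lemma nstep0 s A : nstep P 0 s A = (\1_A s)%:E.
Proof.
rewrite -(transition_pow0_esum s (fun t => (\1_A t)%:E)); last first.
  by move=> t; rewrite lee_fin indicE ler0n.
rewrite /nstep esum_mkcond; apply: eq_esum => t _.
by rewrite indicE; case: ifP; rewrite (mule1, mule0).
Qed.

Lemma nstepS n s A :
  nstep P n.+1 s A = \esum_(u in [set: S]) (P s u)%:E * nstep P n u A.
Proof.
rewrite /nstep /= esum_exchange; last first.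
  by move=> t u; rewrite mule_ge0 ?transition_pow_ge0// lee_fin (proj1 hP).
apply: eq_esum => u _; rewrite ge0_esumZl//; first exact: (proj1 hP).
by move=> t; exact: transition_pow_ge0.
Qed.

Lemma nstepT n s : nstep P n s setT = 1.
Proof.
elim: n s => [|n IH] s; first by rewrite nstep0 indicE in_setT.
rewrite nstepS -[RHS](proj2 hP s); apply: eq_esum => u _.
by rewrite IH mule1.
Qed.

Lemma nstepC n s A : nstep P n s A + nstep P n s (~` A) = 1.
Proof.
rewrite -(nstepT n s) /nstep [RHS](esumID A) ?setTI//.
by move=> t _; exact: transition_pow_ge0.
Qed.

Lemma nstep_le1 n s A : nstep P n s A <= 1.
Proof. by rewrite -(nstepC n s A) leeDl// nstep_ge0. Qed.

Lemma nstep_fin_num n s A : nstep P n s A \is a fin_num.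
Proof.
by rewrite ge0_fin_numE ?nstep_ge0// (le_lt_trans (nstep_le1 n s A))// ltry.
Qed.

Lemma nstep_setC n s A : nstep P n s (~` A) = 1 - nstep P n s A.
Proof. by rewrite -(nstepC n s A) addeAC subee ?add0e// nstep_fin_num. Qed.

Lemma transition_pow_fin_num n s t : transition_pow P n s t \is a fin_num.
Proof.
rewrite -(esum_set1 (t := t) (a := transition_pow P n s)).
  exact: nstep_fin_num.
exact: transition_pow_ge0.
Qed.

(** The definition of [transition_pow] splits off the first step; splitting off the last one instead
    lets two laws at time [n] be compared through the same one-step kernel. *)
Lemma nstepSr n s A : nstep P n.+1 s A =
  \esum_(u in [set: S]) transition_pow P n s u * nstep P 1 u A.
Proof.
have f0 u := nstep_ge0 1 u A; have tp0 := transition_pow_ge0.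
have P0 t u : 0 <= (P t u)%:E by rewrite lee_fin (proj1 hP).
elim: n s => [|n IH] s; first by rewrite transition_pow0_esum.
rewrite nstepS.
transitivity (\esum_(v in [set: S]) \esum_(u in [set: S])
    (P s v)%:E * (transition_pow P n v u * nstep P 1 u A)).
  apply: eq_esum => v _; rewrite IH ge0_esumZl//; first exact: (proj1 hP).
  by move=> u; rewrite mule_ge0.
rewrite esum_exchange => [|v u]; last by rewrite !mule_ge0.
apply: eq_esum => u _ /=.
rewrite muleC -(fineK (nstep_fin_num 1 u A)) -ge0_esumZl ?fine_ge0//; last first.
  by move=> v; rewrite mule_ge0.
by apply: eq_esum => v _; rewrite muleA muleC.
Qed.

End nstep.

(** * Events of the natural filtration and entry events *)

Section natural_filtration.
Context {Omega S : Type} {X : nat -> Omega -> S}.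
Implicit Types (n : nat) (B C : set Omega).

Lemma natural_filtration_preimage n k (A : set S) :
  (k <= n)%N -> natural_filtration X n (X k @^-1` A).
Proof. by move=> kn; apply: sub_sigma_algebra; exists k, A. Qed.

Lemma natural_filtrationS n B :
  natural_filtration X n B -> natural_filtration X n.+1 B.
Proof.
apply: sub_sigma_algebra2 => C [k [A [kn ->]]].
by exists k, A; split => //; exact: leqW.
Qed.

Lemma natural_filtrationC n B :
  natural_filtration X n B -> natural_filtration X n (~` B).
Proof. by move=> nB; rewrite -setTD; exact: sigma_algebraCD. Qed.

Lemma natural_filtrationU n B C : natural_filtration X n B ->
  natural_filtration X n C -> natural_filtration X n (B `|` C).
Proof.
move=> nB nC; rewrite -bigcup2E; apply: sigma_algebra_bigcup => i.
by rewrite /bigcup2; case: ifP => // _; case: ifP => // _; exact: sigma_algebra0.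
Qed.

Lemma natural_filtrationI n B C : natural_filtration X n B ->
  natural_filtration X n C -> natural_filtration X n (B `&` C).
Proof.
move=> nB nC; rewrite -[B `&` C]setCK setCI.
by apply: natural_filtrationC; apply: natural_filtrationU;
  exact: natural_filtrationC.
Qed.

End natural_filtration.

(** The target set depends on time because it will be a level set of [nstep P (N - k) u A], which
    changes with [k]. *)
Definition visited {Omega S : Type} (X : nat -> Omega -> S)
    (G : nat -> set S) (n : nat) : set Omega :=
  [set w | exists2 k, (k <= n)%N & G k (X k w)].

(** The second, disjoint piece is the event that the first entry happens at time [n.+1]. *)
Lemma visitedS {Omega S : Type} (X : nat -> Omega -> S) (G : nat -> set S) n :
  visited X G n.+1 = visited X G n `|` (X n.+1 @^-1` G n.+1 `\` visited X G n).
Proof.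
rewrite setUDr setDv setD0; apply/seteqP; split => w /=.
  move=> [k]; rewrite leq_eqVlt => /orP[/eqP -> ?|kn Gk]; first by right.
  by left; exists k.
by move=> [[k kn Gk]|Gn]; [exists k => //; exact: leqW|exists n.+1].
Qed.

Lemma natural_filtration_visited {Omega S : Type} (X : nat -> Omega -> S)
  (G : nat -> set S) n : natural_filtration X n (visited X G n).
Proof.
elim: n => [|n IH].
  rewrite (_ : visited _ _ _ = X 0%N @^-1` G 0%N).
    exact: natural_filtration_preimage.
  apply/seteqP; split=> w /=; last by exists 0%N.
  by move=> [k]; rewrite leqn0 => /eqP ->.
rewrite visitedS setDE; apply: natural_filtrationU.
  exact: natural_filtrationS.
apply: natural_filtrationI; first exact: natural_filtration_preimage.
by apply: natural_filtrationC; exact: natural_filtrationS.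
Qed.

(** * The Markov property and the maximal inequality *)

Section markov_chain.
Context {d : measure_display} {Omega : measurableType d} {R : realType}.
Context {Pr : probability Omega R} {S : countType} {P : S -> S -> R}.
Context {X : nat -> Omega -> S}.
Hypotheses (hP : transition_matrix P) (hX : markov_chain Pr P X).

Let mX n A : measurable (X n @^-1` A). Proof. exact: (proj1 hX). Qed.

Lemma natural_filtration_measurable {n B} :
  natural_filtration X n B -> measurable B.
Proof.
apply: smallest_sub; first exact: sigma_algebra_measurable.
by move=> _ [k [A [_ ->]]].
Qed.

(** Induction on [m] with [k], [u] and [B] free: intersecting [B] with [X k.+1 = v] gives an event
    of the filtration at time [k.+1], to which the hypothesis for [m] applies. Its probability is
    [P u v] times that of [B], as the integrand in the Markov clause is constant on [B]. *)
Lemma markov_property k m u (B : set Omega) (A : set S) :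
    natural_filtration X k B -> B `<=` X k @^-1` [set u] ->
  Pr (B `&` X (k + m)%N @^-1` A) = nstep P m u A * Pr B.
Proof.
elim: m k u B => [|m IH] k u B nB Bu.
  rewrite addn0 nstep0 indicE; case: (pselect (A u)) => Au.
    rewrite mem_set// mul1e setIidl// => w Bw /=.
    by rewrite (Bu _ Bw).
  rewrite memNset// mul0e -[RHS](measure0 Pr); congr (Pr _).
  by rewrite -subset0 => w [/Bu /= ->].
have mB := natural_filtration_measurable nB.
rewrite (measure_esum_preimage Pr (X k.+1)); last 2 first.
- exact: measurableI.
- by move=> t; exact: mX.
rewrite nstepS// muleC -(fineK (fin_num_measure Pr _ mB)).
rewrite -ge0_esumZl; last 2 first.
- by rewrite fine_ge0.
- by move=> v; rewrite mule_ge0 ?nstep_ge0// lee_fin (proj1 hP).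
apply: eq_esum => v _.
rewrite fineK ?fin_num_measure// setIAC addnS -addSn.
rewrite [LHS](IH k.+1 v); last 2 first.
- apply: natural_filtrationI; first exact: natural_filtrationS.
  exact: natural_filtration_preimage.
- by move=> w [].
rewrite (proj2 hX)// (_ : \int[_]_(_ in _) _ = (P u v)%:E * Pr B); last first.
  by rewrite -integral_cst//; apply: eq_integral => w /[!inE] /Bu /= ->.
by rewrite muleC muleAC muleC.
Qed.

(** [B] is cut along the values of [X k]; pieces with a value outside [G] are empty, the others obey
    [markov_property]. *)
Lemma markov_lower_bound k m (B : set Omega) (A G : set S) (c : R) :
    (0 <= c)%R -> natural_filtration X k B -> B `<=` X k @^-1` G ->
    (forall u, G u -> c%:E <= nstep P m u A) ->
  c%:E * Pr B <= Pr (B `&` X (k + m)%N @^-1` A).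
Proof.
move=> c0 nB BG cG; have mB := natural_filtration_measurable nB.
rewrite (measure_esum_preimage Pr (X k) mB)// -ge0_esumZl//.
rewrite [leRHS](measure_esum_preimage Pr (X k))//; last exact: measurableI.
apply: le_esum => u _; rewrite setIAC.
rewrite [leRHS](markov_property k m u); last 2 first.
- by apply: natural_filtrationI => //; exact: natural_filtration_preimage.
- by move=> w [].
case: (pselect (G u)) => [Gu|nGu]; first by rewrite lee_wpmul2r ?cG.
rewrite (_ : _ `&` _ = set0) ?measure0 ?mule0//.
by rewrite -subset0 => w [/BG /= + /= wu]; rewrite wu.
Qed.

(** This is the Markov property at time 0 on the almost sure event [X 0 = x], whose complement
    contributes a null set. *)
Lemma nstep_markov_chain x n A : Pr (X 0%N @^-1` [set x]) = 1 ->
  nstep P n x A = Pr (X n @^-1` A).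
Proof.
move=> X0.
have := @markov_property 0 n x (X 0%N @^-1` [set x]) A.
rewrite X0 mule1 add0n => <-//; last exact: natural_filtration_preimage.
rewrite [RHS](measureDI _ _ (mX 0%N [set x]))// [X in X + _](_ : _ = 0).
  by rewrite add0e setIC.
apply: (subset_measure0 (B := ~` (X 0%N @^-1` [set x]))).
- exact: measurableD.
- exact: measurableC.
- by move=> w [].
- by rewrite -[LHS]/(Pr _) probability_setC// X0 subee.
Qed.

(* Doob's maximal inequality for the martingale [nstep P (N - k) (X k) A]. *)
Lemma visited_maximal (G : nat -> set S) N A (c : R) : (0 <= c)%R ->
    (forall k u, (k <= N)%N -> G k u -> c%:E <= nstep P (N - k) u A) ->
  c%:E * Pr (visited X G N) <= Pr (X N @^-1` A).
Proof.
move=> c0 cG.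
have mV k := natural_filtration_measurable (natural_filtration_visited X G k).
(* Keeping the intersection with [visited X G k] on the right makes both sides additive over the
   disjoint first-entry pieces, so that the induction closes. *)
suff vis k : (k <= N)%N ->
    c%:E * Pr (visited X G k) <= Pr (visited X G k `&` X N @^-1` A).
  apply: le_trans (vis _ (leqnn N)) _.
  by rewrite le_measure ?inE//; exact: measurableI.
elim: k => [|k IH] kN.
  have := @markov_lower_bound 0 N (visited X G 0) A (G 0%N) c.
  apply => //; first exact: natural_filtration_visited.
    by move=> w [k] /=; rewrite leqn0 => /eqP ->.
  by move=> u G0u; rewrite -[N in nstep _ N]subn0 cG.
set D := X k.+1 @^-1` G k.+1 `\` visited X G k.
have VD0 : visited X G k `&` D = set0 by rewrite /D setDIK.
have mD : measurable D by exact: measurableD.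
rewrite visitedS setIUl !measureU//; first last.
- by rewrite setIACA VD0 set0I.
- exact: measurableI.
- exact: measurableI.
rewrite ge0_muleDr// leeD// ?IH 1?ltnW//.
(* The first-entry event [D] is decided at time [k.+1], which leaves [N - k.+1] steps up to the
   horizon. *)
rewrite -{1}(subnKC kN); apply: (markov_lower_bound k.+1 _ _ _ (G k.+1)) => //.
- apply: natural_filtrationI; first exact: natural_filtration_preimage.
  apply: natural_filtrationC; apply: natural_filtrationS.
  exact: natural_filtration_visited.
- by move=> u; exact: cG.
Qed.

End markov_chain.

(** * Monotonicity of the total variation distance *)

Lemma lee_abseB {R : realDomainType} (a b c : \bar R) :
  a \is a fin_num -> b \is a fin_num ->
  a - b <= c -> b - a <= c -> `|a - b| <= c.
Proof.
case: a => [a| |]// _; case: b => [b| |]// _.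
rewrite -!EFinB /= -[(b - a)%R]opprB.
by case: (ger0P (a - b)%R).
Qed.

(** One more step integrates the [[0,1]]-valued function [nstep P 1 u A] of [u] against the
    difference of the two laws at time [n]. Replacing it by the indicator of the set where this
    difference is nonnegative cannot decrease the integral. *)
Lemma tv_dist_nstepS {R : realType} {S : countType} {P : S -> S -> R} n x y :
    transition_matrix P ->
  tv_dist (nstep P n.+1 x) (nstep P n.+1 y) <=
  tv_dist (nstep P n x) (nstep P n y).
Proof.
move=> hP.
have half s t A : exists B, nstep P n.+1 s A - nstep P n.+1 t A <=
    `|nstep P n s B - nstep P n t B|.
  (* The positive set of the Hahn decomposition of [P^n(s, .) - P^n(t, .)]. *)
  exists [set u | transition_pow P n t u <= transition_pow P n s u].
  set B := [set u | _].
  apply: le_trans (lee_abs _).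
  (* Moving the subtracted terms across leaves nonnegative sums on both sides, which can be compared
     term by term. *)
  rewrite leeBlDr ?nstep_fin_num// addeAC leeBrDr ?nstep_fin_num//.
  rewrite !(nstepSr hP n) ![nstep P n _ B]esum_mkcond.
  have f0 u := nstep_ge0 hP 1 u A.
  have tp0 v u := transition_pow_ge0 hP n v u.
  have ite0 v u : 0 <= (if u \in B then transition_pow P n v u else 0).
    by case: ifP.
  rewrite -!esumD//; try by move=> *; rewrite mule_ge0.
  apply: le_esum => u _.
  have uB : (u \in B) = (transition_pow P n t u <= transition_pow P n s u).
    by apply/idP/idP => [/set_mem|/mem_set].
  rewrite {}uB; move: (f0 u) (nstep_le1 hP 1 u A).
  rewrite -(fineK (nstep_fin_num hP 1 u A)).
  rewrite -(fineK (transition_pow_fin_num hP n s u)).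
  rewrite -(fineK (transition_pow_fin_num hP n t u)) !lee_fin => g0 g1.
  (* With [a], [b] the masses of [u] under the laws from [s], [t] and [g] the one-step probability:
     if [b <= a], the claim [a g + b <= a + b g] is [0 <= (a - b)(1 - g)]; otherwise it is
     [a g <= b g]. *)
  case: ifPn; rewrite -?ltNge => ba;
    rewrite ?(adde0, add0e) -!EFinM -?EFinD lee_fin; nra.
apply: ge_ereal_sup => _ /= [A _ <-].
have tvB s t B : `|nstep P n s B - nstep P n t B| <=
    tv_dist (nstep P n s) (nstep P n t).
  by apply: ereal_sup_ubound; exists B.
have [B xyB] := half x y A; have [C yxC] := half y x A.
apply: lee_abseB; rewrite ?nstep_fin_num//.
  exact: le_trans xyB (tvB _ _ B).
apply: le_trans yxC _; rewrite -abseN fin_num_oppeB ?nstep_fin_num// addeC.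
exact: tvB.
Qed.

(** * The bound at a finite horizon *)

Definition met_by {Omega S : Type} (X Y : nat -> Omega -> S) (n : nat) :
    set Omega :=
  [set w | exists2 k, (k <= n)%N & X k w = Y k w].

Section meeting.
Context {d : measure_display} {Omega : measurableType d} {R : realType}.
Context {Pr : probability Omega R} {S : countType} {P : S -> S -> R}.
Context {X Y : nat -> Omega -> S}.
Hypotheses (hP : transition_matrix P).
Hypotheses (hX : markov_chain Pr P X) (hY : markov_chain Pr P Y).

(** Cutting along the common value gives a countable union of events that each involve the two
    chains separately. *)
Lemma measurable_met_by n : measurable (met_by X Y n).
Proof.
rewrite (_ : met_by X Y n = \bigcup_(k in [set k | (k <= n)%N])
    \bigcup_(t : S) (X k @^-1` [set t] `&` Y k @^-1` [set t])).
  apply: bigcup_measurable => k _; apply: countable_bigcupT_measurable => // t.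
  by apply: measurableI; [exact: (proj1 hX)|exact: (proj1 hY)].
apply/seteqP; split=> [w [k kn XY]|w [k kn [t _ [/= Xt Yt]]]].
  by exists k => //; exists (X k w).
by exists k => //; rewrite Xt Yt.
Qed.

Lemma met_by_bound x y N A :
    Pr (X 0%N @^-1` [set x]) = 1 -> Pr (Y 0%N @^-1` [set y]) = 1 ->
  nstep P N x A - nstep P N y A <= 1 - (2^-1)%:E * Pr (met_by X Y N).
Proof.
move=> X0 Y0.
pose G B k := [set u | (2^-1)%:E <= nstep P (N - k) u B].
have half0 : (0 <= 2^-1 :> R)%R by rewrite invr_ge0 ler0n.
have XV := visited_maximal hP hX (G (~` A)) N (~` A) _ half0 (fun _ _ _ => id).
have YV := visited_maximal hP hY (G A) N A _ half0 (fun _ _ _ => id).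
rewrite -(nstep_markov_chain hP hX x)// nstep_setC// in XV.
rewrite -(nstep_markov_chain hP hY y)// in YV.
have mXV :=
  natural_filtration_measurable hX (natural_filtration_visited X (G (~` A)) N).
have mYV :=
  natural_filtration_measurable hY (natural_filtration_visited Y (G A) N).
have metU : met_by X Y N `<=` visited X (G (~` A)) N `|` visited Y (G A) N.
  move=> w [k kN XY].
  have [YA|YA] := leP (2^-1)%:E (nstep P (N - k) (Y k w) A).
    by right; exists k.
  left; exists k => //; rewrite /G/= XY nstep_setC//.
  move: YA; have := nstep_fin_num hP (N - k) (Y k w) A.
  case: (nstep P _ _ _) => [r| |]// _.
  by rewrite -EFinB lee_fin lte_fin; lra.
have : (2^-1)%:E * Pr (met_by X Y N) <= 1 - nstep P N x A + nstep P N y A.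
  apply: le_trans (leeD XV YV); rewrite -ge0_muleDr//.
  apply: lee_wpmul2l; first by rewrite lee_fin.
  apply: le_trans (measureU2 _ mXV mYV).
  by rewrite le_measure ?inE//; [exact: measurable_met_by|exact: measurableU].
rewrite -(fineK (nstep_fin_num hP N x A)) -(fineK (nstep_fin_num hP N y A)).
rewrite -(fineK (fin_num_measure Pr _ (measurable_met_by N))).
by rewrite -!EFinM -!EFinB -EFinD !lee_fin; lra.
Qed.

End meeting.

(** * Passage to the limit *)

Lemma bigcup_met_by {R : realType} {Omega S : Type} (X Y : nat -> Omega -> S) :
  \bigcup_n (met_by X Y n) = [set w | meeting_time R X Y w < +oo].
Proof.
apply/seteqP; split=> w.
  move=> [n _ [k _ XY]]; apply: le_lt_trans (ltry k%:R).
  by apply: ereal_inf_lbound; exists k.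
(* An infimum below [+oo] forces some meeting index to exist. *)
by move=> /ereal_inf_lt[_ [n XY <-] _]; exists n => //; exists n.
Qed.

Theorem theorem4p1 (R : realType) (S : countType) (P : S -> S -> R)
    (hP : transition_matrix P) (x y : S)
    (d : measure_display) (Omega : measurableType d) (Pr : probability Omega R)
    (X Y : nat -> Omega -> S)
    (hXY : coupling Pr P x y X Y)
    (hmeet : Pr [set w | meeting_time R X Y w < +oo] = 1) :
  cvgn (fun n => tv_dist (nstep P n x) (nstep P n y)) /\
  limn (fun n => tv_dist (nstep P n x) (nstep P n y)) <= (2^-1)%:E.
Proof.
case: hXY => hX hY X0 Y0.
have cvg_tv : cvgn (fun n => tv_dist (nstep P n x) (nstep P n y)).
  apply: ereal_nonincreasing_is_cvgn.
  by apply/nonincreasing_seqP => n; exact: tv_dist_nstepS.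
split=> //.
pose u n := 1 - (2^-1)%:E * Pr (met_by X Y n).
have tv_le n : tv_dist (nstep P n x) (nstep P n y) <= u n.
  apply: ge_ereal_sup => _ /= [A _ <-]; apply: lee_abseB; rewrite ?nstep_fin_num//.
    exact: met_by_bound.
  (* Passing to the complement of [A] reverses the sign of the difference, so the one-sided bound
     also controls the absolute value. *)
  have := met_by_bound hP hX hY x y n (~` A) X0 Y0.
  rewrite !nstep_setC// -/(u n); apply: le_trans.
  rewrite -(fineK (nstep_fin_num hP n x A)) -(fineK (nstep_fin_num hP n y A)).
  by rewrite -!EFinB lee_fin; lra.
have met_cvg : Pr (met_by X Y n) @[n --> \oo] --> 1.
  (* Continuity from below: the events [met_by X Y n] increase to the event that the meeting time is
     finite. *)
  rewrite -hmeet -bigcup_met_by; apply: nondecreasing_cvg_mu.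
  - by move=> n; exact: measurable_met_by hX hY n.
  - by apply: bigcupT_measurable => n; exact: measurable_met_by hX hY n.
  - move=> m n mn; apply/subsetPset => w [k km XY].
    by exists k => //; exact: leq_trans mn.
have u_cvg : u n @[n --> \oo] --> (2^-1)%:E.
  rewrite (_ : (2^-1)%:E = 1 - (2^-1)%:E * 1); last first.
    by rewrite mule1 -EFinB; congr (_%:E); lra.
  apply: cvgeB => //; first exact: cvg_cst.
  by apply: cvgeZl.
rewrite -(cvg_lim _ u_cvg)//; apply: lee_lim => //.
  by apply/cvg_ex; eexists; exact: u_cvg.
exact: nearW.
Qed.
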